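(* Let $X=(V,E)$ be a finite simple connected graph with $n\geq 3$ vertices and $m$ edges. Then the edge-flipping group $\mathbf{W}_E(X)$ is isomorphic to $$ \left\{ \begin{array}{ll} \mathcal{B}^{m-n+1}\rtimes_{\theta}S_n, &\hbox{if $n$ is odd;}\\ \mathcal{B}_e^{m-n+1}\rtimes_{\theta}S_n, &\hbox{if $n$ is even.} \end{array} \right. $$
   Context: Edges are 2-element subsets of $V$. The edge space $\mathcal{E}$ of $X=(V,E)$ is the power set of $E$, viewed as a vector space over $\mathbf{F}_2=\{0,1\}$ with symmetric difference as addition. For $U\subseteq V$, $E(U)\in\mathcal{E}$ is the set of edges having exactly one element in $U$; write $E(v)=E(\{v\})$ for $v\in V$. For $\epsilon=\{x,y\}\in E$, $E(\epsilon)=E(\{x,y\})$ is the set of edges $\epsilon'$ with $|\epsilon'\cap\epsilon|=1$. The bond space $\mathcal{B}$ is the subspace of $\mathcal{E}$ spanned by $\{E(v)\mid v\in V\}$; it has dimension $n-1$. Edge-flipping group: for $\epsilon\in E$ let $\bm{\rho}_\epsilon:\mathcal{E}\to\mathcal{E}$ be the invertible linear map with $\bm{\rho}_\epsilon G=G+E(\epsilon)$ if $\epsilon\in G$ and $\bm{\rho}_\epsilon G=G$ otherwise. $\mathbf{W}_E(X)$ is the subgroup of $\mathrm{GL}(\mathcal{E})$ generated by $\{\bm{\rho}_\epsilon\mid\epsilon\in E\}$. For $n\ge 3$ the sets $E(v)$, $v\in V$, are pairwise distinct, and $S_n$ denotes the symmetric group on the $n$-element set $\{E(v)\mid v\in V\}$.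 Simple weight: fix a vertex $u\in V$. The set $\Delta=\{E(v)\mid v\in V-\{u\}\}$ is a basis of $\mathcal{B}$ (and $E(u)=\sum_{v\ne u}E(v)$). For $G\in\mathcal{B}$, $sw(G)$ is the number of elements of $\Delta$ in the unique expression of $G$ as a sum of distinct elements of $\Delta$. Put $\mathcal{B}_e=\{G\in\mathcal{B}\mid sw(G)\text{ is even}\}$, an $(n-2)$-dimensional subspace of $\mathcal{B}$. $\mathcal{B}^{m-n+1}$ and $\mathcal{B}_e^{m-n+1}$ denote the direct sums of $m-n+1$ copies of $\mathcal{B}$ and $\mathcal{B}_e$ respectively (as additive groups). $\theta:S_n\to\mathrm{Aut}(\mathcal{B}^{m-n+1})$ is the group homomorphism determined by $\theta(\sigma)(E(v_i))_{i=1}^{m-n+1}=(\sigma(E(v_i)))_{i=1}^{m-n+1}$ for $v_1,\ldots,v_{m-n+1}\in V$, $\sigma\in S_n$ (that is, each $\sigma$ extends uniquely to a linear map of $\mathcal{B}$, applied componentwise). $\mathcal{B}^{m-n+1}\rtimes_\theta S_n$ is the set $\mathcal{B}^{m-n+1}\times S_n$ with the group operation $$((G_i)_i,\sigma)((H_i)_i,\tau)=((G_i)_i+\theta(\sigma)(H_i)_i,\ \sigma\tau).$$ When $n$ is even, $\mathcal{B}_e^{m-n+1}$ is preserved by every $\theta(\sigma)$, and $\mathcal{B}_e^{m-n+1}\rtimes_\theta S_n$ is the subgroup with underlying set $\mathcal{B}_e^{m-n+1}\times S_n$. *)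

(* Defs.v *)
From HB Require Import structures.
From mathcomp Require Import all_boot all_order all_algebra all_fingroup all_solvable.

Set Implicit Arguments.
Unset Strict Implicit.
Unset Printing Implicit Defensive.

Import GRing.Theory.
Local Open Scope ring_scope.

(* A finite simple graph, given by its set of 2-element edges. *)
Record sgraph (V : finType) := SGraph {
  edges :> {set {set V}};
  edges_card2 : {in edges, forall e : {set V}, #|e| = 2%N}
}.

Section EdgeSpace.
Variables (V : finType) (X : sgraph V).
Implicit Types (U : {set V}).

Definition adj : rel V := fun x y => [set x; y] \in edges X.

Definition connected_graph : Prop := forall x y : V, connect adj x y.

Definition edge : finType := {e : {set V} | e \in edges X}.

(* The edge space: the power set of the edge set, with symmetric difference as
   addition. *)
Definition espace := {set edge}.
HB.instance Definition _ := Finite.on espace.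
Implicit Types (G H : espace).

Definition espace_add G H : espace := (G :\: H) :|: (H :\: G).

Lemma in_espace_add G H e :
  (e \in espace_add G H) = (e \in G) (+) (e \in H).
Proof. by rewrite !inE; case: (e \in G); case: (e \in H). Qed.

Lemma espace_addA : associative espace_add.
Proof. by move=> G H K; apply/setP=> e; rewrite !in_espace_add addbA. Qed.
Lemma espace_addC : commutative espace_add.
Proof. by move=> G H; apply/setP=> e; rewrite !in_espace_add addbC. Qed.
Lemma espace_add0 : left_id (set0 : espace) espace_add.
Proof. by move=> G; apply/setP=> e; rewrite in_espace_add inE. Qed.
Lemma espace_addN : left_inverse (set0 : espace) id espace_add.
Proof. by move=> G; apply/setP=> e; rewrite in_espace_add inE addbb. Qed.

HB.instance Definition _ := GRing.isZmodule.Build espace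
  espace_addA espace_addC espace_add0 espace_addN.

Lemma in_espaceD G H e : (e \in G + H) = (e \in G) (+) (e \in H).
Proof. exact: in_espace_add. Qed.

Lemma in_espace0 e : (e \in (0 : espace)) = false.
Proof. exact: in_set0. Qed.

Lemma espaceDD G : G + G = 0.
Proof. exact: espace_addN. Qed.

Definition espace_scale (a : 'F_2) G : espace := if a == 0 then 0 else G.

Lemma F2P (a : 'F_2) : a = 0 \/ a = 1.
Proof. by case: a => [[|[|//]] ?]; [left | right]; apply: val_inj. Qed.

Lemma espace_scaleA a b G :
  espace_scale a (espace_scale b G) = espace_scale (a * b) G.
Proof.
by case: (F2P a) => ->; case: (F2P b) => ->;
   rewrite /espace_scale ?(mul0r, mulr0, mulr1) ?eqxx ?oner_eq0.
Qed.
Lemma espace_scale1 : left_id 1 espace_scale.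
Proof. by move=> G; rewrite /espace_scale oner_eq0. Qed.
Lemma espace_scaleDr : right_distributive espace_scale +%R.
Proof. by move=> a G H; rewrite /espace_scale; case: eqP; rewrite ?addr0. Qed.
Lemma espace_scaleDl G : {morph espace_scale^~ G : a b / a + b}.
Proof.
have e2 : (1 + 1 : 'F_2) = 0 by apply: val_inj.
by move=> a b; case: (F2P a) => ->; case: (F2P b) => ->;
   rewrite /espace_scale ?(e2, add0r, addr0) ?eqxx ?oner_eq0
           ?(add0r, addr0, espaceDD).
Qed.

HB.instance Definition _ := GRing.Zmodule_isLmodule.Build 'F_2 espace
  espace_scaleA espace_scale1 espace_scaleDr espace_scaleDl.

Lemma espace_vect_iso : Vector.axiom #|edge| espace.
Proof.
pose f G : 'rV['F_2]_#|edge| := \row_i (enum_val i \in G)%:R.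
pose g (v : 'rV['F_2]_#|edge|) : espace := [set e | v 0 (enum_rank e) != 0].
exists f; last exists g.
- move=> a G H; apply/rowP=> i; rewrite !mxE in_espaceD.
  case: (F2P a) => ->.
    by rewrite mul0r add0r scale0r in_espace0.
  rewrite mul1r scale1r; case: (_ \in G); case: (_ \in H) => //=;
  by apply: val_inj.
- move=> G; apply/setP=> e; rewrite inE mxE enum_rankK.
  by case: (e \in G); rewrite ?oner_eq0 ?eqxx.
- move=> v; apply/rowP=> i; rewrite mxE inE enum_valK.
  by case: (F2P (v 0 i)) => ->; rewrite ?oner_eq0 ?eqxx.
Qed.

HB.instance Definition _ := Lmodule_hasFinDim.Build 'F_2 espace espace_vect_iso.

(* E(U), with E(v) = cut [set v] and E(e) = cut (val e). *)
Definition cut U : espace := [set e : edge | #|val e :&: U| == 1%N].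

Definition rho_fun (e : edge) G : espace := if e \in G then G + cut (val e) else G.

Lemma rho_funK e : involutive (rho_fun e).
Proof.
have nee : e \in cut (val e) = false.
  by rewrite inE setIid (edges_card2 (valP e)).
move=> G; rewrite /rho_fun; case eG: (e \in G); last by rewrite eG.
by rewrite in_espaceD eG nee /= -addrA espaceDD addr0.
Qed.

Definition rho (e : edge) : {perm espace} := perm (inv_inj (rho_funK e)).

Definition GLespace : {set {perm espace}} :=
  [set s : {perm espace} | [forall a : 'F_2, forall G, forall H,
              s (a *: G + H) == a *: s G + s H]].

(* The subgroup of GL(espace) generated by the rho e. The product of {perm _}
   is composition from left to right, which yields the opposite, hence
   isomorphic, group. *)
Definition edge_flipping_group : {group {perm espace}} :=
  <<[set rho e | e : edge]>>%G.

Lemma edge_flipping_group_subGL : edge_flipping_group \subset GLespace.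
Proof.
have gGL : group_set GLespace.
  apply/group_setP; split=> [|s t]; rewrite !inE.
    by apply/forallP=> a; apply/forallP=> G; apply/forallP=> H; rewrite !perm1.
  move=> /forallP hs /forallP ht.
  apply/forallP=> a; apply/forallP=> G; apply/forallP=> H; rewrite !permM.
  have /forallP/(_ G)/forallP/(_ H)/eqP-> := hs a.
  by have /forallP/(_ (s G))/forallP/(_ (s H)) := ht a.
rewrite (gen_subG _ (Group gGL)) /=; apply/subsetP=> _ /imsetP[e _ ->].
rewrite inE; apply/forallP=> a; apply/forallP=> G; apply/forallP=> H; apply/eqP.
rewrite !permE /rho_fun in_espaceD; case: (F2P a) => ->.
  by rewrite !scale0r in_espace0 /= !add0r.
rewrite !scale1r; case: (e \in G); case: (e \in H) => //=.
- by rewrite addrACA espaceDD addr0.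
- by rewrite addrAC.
- by rewrite addrA.
Qed.

Definition bond_space : {vspace espace} :=
  <<[seq cut [set v] | v <- enum V]>>%VS.

End EdgeSpace.


Section BondSpace.
Variables (V : finType) (X : sgraph V).

Definition bond := subvs_of (bond_space X).

HB.instance Definition _ := Vector.on bond.
HB.instance Definition _ := SubType.on bond.
HB.instance Definition _ := [Countable of bond by <:].
HB.instance Definition _ := [Finite of bond by <:].
HB.instance Definition _ := [finGroupMixin of bond for +%R].

(* m - n + 1 is written m.+1 - n because subtraction is truncated and
   m = n - 1 for a tree. *)
Definition bpow := {ffun 'I_(#|edges X|.+1 - #|V|) -> bond}.

HB.instance Definition _ := GRing.Zmodule.on bpow.
HB.instance Definition _ := Finite.on bpow.
HB.instance Definition _ := [finGroupMixin of bpow for +%R].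


Lemma star_subproof (v : V) : cut X [set v] \in bond_space X.
Proof. by apply: memv_span; apply: map_f; rewrite mem_enum. Qed.

Definition star (v : V) : bond := Subvs (star_subproof v).

Definition stars : {set bond} := [set star v | v : V].

(* The symmetric group S_n is {perm starT}. *)
Definition starT : finType := {H : bond | H \in stars}.

Lemma star_in v : star v \in stars. Proof. exact: imset_f. Qed.

Definition star_elt (v : V) : starT := Sub (star v) (star_in v).

Implicit Types (U W : {set V}) (D : {set starT}) (G H : bond) (s t : {perm starT}).

(* Some set of stars summing to G. When X is connected and n >= 3 there are
   exactly two, complementary to each other since the sum of all stars is 0. *)
Definition star_decomp G : {set starT} :=
  odflt set0 [pick D : {set starT} | \sum_(H in D) val H == G].

(* The linear extension of s to the bond space; see thext_linear and
   thext_star. *)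
Definition thext s G : bond := \sum_(H in star_decomp G) val (s H).

Definition Delta (u : V) : {set bond} := [set star v | v in [set~ u]].

(* The size of the expression of G in the basis Delta u; see Delta_expr. *)
Definition sw (u : V) G : nat :=
  #|odflt set0 [pick D : {set bond} | (D \subset Delta u)
                                      && (\sum_(H in D) H == G)]|.

Definition even_bond (u : V) : {set bond} := [set G | ~~ odd (sw u G)].

Lemma bondDD G : G + G = 0.
Proof. by apply: val_inj; rewrite linearD /= espaceDD. Qed.

Lemma bondN G : - G = G.
Proof. by apply/eqP; rewrite eq_sym -subr_eq0 opprK bondDD. Qed.

Lemma in_espace_sum (I : finType) (P : pred I) (F : I -> espace X) e :
  (e \in \sum_(i | P i) F i) = odd (\sum_(i | P i) (e \in F i)).
Proof.
elim/big_rec2: _ => [|i n G _ IH]; first exact: in_espace0.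
rewrite in_espaceD oddD IH; by case: (e \in F i).
Qed.

Lemma cut_sum U : cut X U = \sum_(v in U) cut X [set v].
Proof.
apply/setP=> e; rewrite in_espace_sum inE.
have -> : (\sum_(v in U) (e \in cut X [set v]) = #|val e :&: U|)%N.
  rewrite -sum1_card big_mkcond [RHS]big_mkcond /=; apply: eq_bigr => v _.
  rewrite !inE; case: (v \in U); last by rewrite andbF.
  case: (boolP (v \in val e)) => ve /=.
    by rewrite (setIidPr _) ?sub1set ?cards1.
  suff -> : val e :&: [set v] = set0 by rewrite cards0.
  by apply/eqP; rewrite setI_eq0 disjoint_sym disjoints1.
have := subset_leq_card (subsetIl (val e) U).
rewrite (edges_card2 (valP e)).
by case: #|_ :&: U| => [|[|[|]]].
Qed.

Lemma val_star_sum U : val (\sum_(v in U) star v) = cut X U.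
Proof. by rewrite cut_sum linear_sum. Qed.

Lemma star_sum_add U W :
  \sum_(v in U) star v + \sum_(v in W) star v
    = \sum_(v in (U :\: W) :|: (W :\: U)) star v.
Proof.
rewrite !(big_mkcond (fun v => v \in _)) -big_split /=; apply: eq_bigr => v _.
rewrite !inE; case: (v \in U); case: (v \in W); rewrite ?bondDD ?addr0 ?add0r //.
Qed.

Lemma star_sumT : \sum_v star v = 0.
Proof.
apply: val_inj; transitivity (cut X setT).
  by rewrite -val_star_sum; congr val; apply: eq_bigl => v; rewrite inE.
apply/setP=> e; rewrite inE setIT in_espace0.
by rewrite (edges_card2 (valP e)).
Qed.

Lemma bondP G : exists U, G = \sum_(v in U) star v.
Proof.
suff [U eU] : exists U, val G = cut X U.
  by exists U; apply: val_inj; rewrite val_star_sum.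
have cut0 : cut X set0 = 0 by rewrite cut_sum big_set0.
have cutD U W : exists Z, cut X U + cut X W = cut X Z.
  exists ((U :\: W) :|: (W :\: U)).
  by rewrite -!val_star_sum -star_sum_add linearD.
have := valP G; move: (val G) => K; rewrite /bond_space => /(@coord_span _ _ _ (in_tuple _)) ->.
apply: (big_ind (fun K : espace X => exists U, K = cut X U)) => [|_ _ [U ->] [W ->]|i _].
- by exists set0.
- exact: cutD.
move: (coord _ _ _) => c; case: (F2P c) => ->; first by exists set0; rewrite scale0r.
rewrite scale1r in_tupleE; have : (i < #|V|)%N.
  by have := ltn_ord i; rewrite [in X in (_ < X)%N]size_map -cardE.
move: (nat_of_ord i) => j ltj.
have [v0 _] := elimT card_gt0P (leq_ltn_trans (leq0n j) ltj).
rewrite (nth_map v0) -?cardE //; by eexists.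
Qed.

Section Connected.
Hypothesis hc : connected_graph X.

Lemma cut_eq0 U : cut X U = 0 -> U = set0 \/ U = setT.
Proof.
move=> U0; have adjU x y : adj X x y -> (x \in U) = (y \in U).
  move=> xy; have /setP/(_ (Sub [set x; y] xy : edge X)) := U0.
  rewrite in_espace0 inE /= => h.
  have xNy : x != y by have := edges_card2 xy; rewrite cards2; case: eqP.
  move: h; case xU: (x \in U); case yU: (y \in U) => //.
    suff -> : [set x; y] :&: U = [set x] by rewrite cards1.
    apply/setP=> z; rewrite !inE; case: (z =P x) => [->|_]; first by rewrite xU.
    by case: (z =P y) => [->|].
  suff -> : [set x; y] :&: U = [set y] by rewrite cards1.
  apply/setP=> z; rewrite !inE; case: (z =P y) => [->|_]; first by rewrite yU orbT.
  by case: (z =P x) => [->|].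
have conU x y : (x \in U) = (y \in U).
  have /connectP[p] := hc x y.
  elim: p x => [|z p IH] x /= => [_ ->//|/andP[/adjU-> zp] ely].
  exact: IH.
case: (set_0Vmem U) => [->|[x xU]]; [by left | right].
by apply/setP=> y; rewrite inE -(conU x) xU.
Qed.

Lemma star_sum_eq U W : \sum_(v in U) star v = \sum_(v in W) star v ->
  W = U \/ W = ~: U.
Proof.
move=> UW; have := star_sum_add U W; rewrite UW bondDD => /esym/(congr1 val).
rewrite val_star_sum => /cut_eq0[] /setP h; [left | right];
by apply/setP=> v; have := h v; rewrite !inE; case: (v \in U); case: (v \in W).
Qed.

Hypothesis hn : (2 < #|V|)%N.

Lemma star_inj : injective star.
Proof.
move=> v w vw; apply: contraTeq hn => vNw; rewrite -leqNgt.
have : \sum_(x in [set v]) star x = \sum_(x in [set w]) star x by rewrite !big_set1.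
case/star_sum_eq => /setP.
  by move/(_ v); rewrite !inE eqxx (negPf vNw).
move=> h; suff <- : #|[set v; w]| = #|V| by rewrite cards2; case: eqP.
rewrite -cardsT; congr #|pred_of_set _|; apply/setP=> x; have := h x.
by rewrite !inE; case: (x == v); case: (x == w).
Qed.

Lemma star_elt_bij : bijective star_elt.
Proof.
apply: inj_card_bij => [v w /(congr1 val) /star_inj //|].
by rewrite card_sig leq_imset_card.
Qed.

Lemma starT_sum D (f : starT -> bond) :
  \sum_(H in D) f H = \sum_(v in star_elt @^-1: D) f (star_elt v).
Proof.
rewrite (reindex star_elt) /=; first by apply: eq_bigl => v; rewrite inE.
exact: onW_bij star_elt_bij.
Qed.

Lemma starT_sumT : \sum_(H : starT) val H = 0.
Proof.
rewrite (reindex star_elt) /=; first exact: star_sumT.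
exact: onW_bij star_elt_bij.
Qed.

Lemma bond_starP G : exists D, G = \sum_(H in D) val H.
Proof.
have [U ->] := bondP G; have [g gK Kg] := star_elt_bij.
exists (g @^-1: U); rewrite starT_sum; apply: eq_bigl => v.
by rewrite !inE gK.
Qed.

Lemma starT_sum_eq D1 D2 :
  \sum_(H in D1) val H = \sum_(H in D2) val H -> D2 = D1 \/ D2 = ~: D1.
Proof.
rewrite !starT_sum => /star_sum_eq h; have [g gK Kg] := star_elt_bij.
by case: h => /setP h; [left | right]; apply/setP=> H; have := h (g H);
   rewrite !inE Kg.
Qed.

Lemma thextE s D : thext s (\sum_(H in D) val H) = \sum_(H in D) val (s H).
Proof.
rewrite /thext /star_decomp; case: pickP => [D' /eqP /starT_sum_eq|/(_ D)].
  case=> ->//; have := starT_sumT; rewrite (reindex_inj (@perm_inj _ s)).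
  rewrite (bigID (mem D')) /= => /eqP; rewrite addr_eq0 bondN => /eqP->.
  by apply: eq_bigl => H; rewrite inE.
by rewrite eqxx.
Qed.

Lemma thext_star s v : thext s (star v) = val (s (star_elt v)).
Proof. by have := thextE s [set star_elt v]; rewrite !big_set1. Qed.

Lemma thext_linear s : linear (thext s).
Proof.
have thD G H : thext s (G + H) = thext s G + thext s H.
  have [D1 ->] := bond_starP G; have [D2 ->] := bond_starP H.
  have symD (f : starT -> bond) : \sum_(H in D1) f H + \sum_(H in D2) f H
      = \sum_(H in (D1 :\: D2) :|: (D2 :\: D1)) f H.
    rewrite !(big_mkcond (fun K : starT => K \in _)) -big_split /=; apply: eq_bigr => K _.
    by rewrite !inE; case: (K \in D1); case: (K \in D2);
       rewrite ?bondDD ?addr0 ?add0r.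
  by rewrite symD !thextE symD.
have th0 : thext s 0 = 0.
  by have := thextE s set0; rewrite !big_set0.
move=> a G H; rewrite thD; case: (F2P a) => ->; last by rewrite !scale1r.
by rewrite !scale0r th0.
Qed.

Lemma thext1 G : thext 1 G = G.
Proof.
have [D ->] := bond_starP G; rewrite thextE.
by apply: eq_bigr => H _; rewrite perm1.
Qed.

Lemma thextM s t G : thext (s * t)%g G = thext t (thext s G).
Proof.
have [D ->] := bond_starP G; rewrite !thextE.
have -> : \sum_(H in D) val (s H) = \sum_(H in s @: D) val H.
  by rewrite big_imset //= => ? ? _ _; apply: perm_inj.
rewrite thextE big_imset /=; last by move=> ? ? _ _; apply: perm_inj.
by apply: eq_bigr => H _; rewrite permM.
Qed.

Definition theta_fun (G : bpow) s : bpow := [ffun i => thext s (G i)].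

Lemma theta_is_action : is_action [set: {perm starT}] theta_fun.
Proof.
split=> [s|G s t _ _].
  apply: (can_inj (g := theta_fun^~ s^-1%g)) => G; apply/ffunP=> i.
  by rewrite !ffunE -thextM mulgV thext1.
by apply/ffunP=> i; rewrite !ffunE thextM.
Qed.

Definition theta_action := Action theta_is_action.

Lemma theta_is_groupAction : is_groupAction [set: bpow] theta_action.
Proof.
move=> s _; rewrite inE; apply/andP; split.
  by apply/subsetP=> G _; rewrite inE.
apply/morphicP=> G H _ _; rewrite !actpermE; apply/ffunP=> i.
rewrite !ffunE /= -[thext s (G i)]scale1r -thext_linear scale1r.
by congr thext; rewrite ffunE.
Qed.

(* MathComp permutations compose from left to right, so theta, a left action
   of permutations under usual composition, is a right action here. *)
Definition theta : groupAction [set: {perm starT}] [set: bpow] :=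
  GroupAction theta_is_groupAction.

Lemma theta_star s (v : 'I_(#|edges X|.+1 - #|V|) -> V) :
  theta [ffun i => star (v i)] s = [ffun i => val (s (star_elt (v i)))].
Proof. by apply/ffunP=> i; rewrite !ffunE thext_star. Qed.

(* The pair (A, s) as an element of sdprod_by theta; sdM is the product rule
   of the customary semidirect product, since (t * s)%g is s \o t. *)
Definition sd (A : bpow) s : sdprod_by theta :=
  (sdpair1 theta A * sdpair2 theta s^-1)%g.

Lemma sdM (A B : bpow) s t :
  (sd A s * sd B t)%g = sd (A + theta B s) (t * s)%g.
Proof.
rewrite /sd invMg (sdpair2_morphM theta) ?inE // (sdpair1_morphM theta) ?inE //.
rewrite (sdpair_act theta) ?inE // /conjg.
have -> : (sdpair2 theta s^-1 = (sdpair2 theta s)^-1)%g.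
  by rewrite (morphV (sdpair2_morphism theta)) ?inE.
by rewrite !mulgA mulgK.
Qed.

Lemma sd_pairE (A : bpow) s : sd A s = (s^-1%g, theta A s^-1%g) :> _ * _.
Proof.
by rewrite /= !val_insubd !inE /= mul1g mulg1.
Qed.

Lemma sd_bij : bijective (fun As : bpow * {perm starT} => sd As.1 As.2).
Proof.
pose g (w : sdprod_by theta) := (theta w.2 w.1^-1%g, w.1^-1%g).
have gsd A s : g (sd A s) = (A, s).
  rewrite /g sd_pairE; congr pair; last exact: invgK.
  have -> : (s^-1, theta A s^-1).1^-1%g = s by exact: invgK.
  by apply: (actKVin theta); rewrite inE.
exists g => [[A s]|w]; first exact: gsd.
apply: val_inj; rewrite [LHS]sd_pairE.
case: w => [[s A] ?]; rewrite /g; congr pair; rewrite /= ?invgK //.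
by apply: (actKVin theta); rewrite inE.
Qed.

Definition even_bpow (u : V) : {set bpow} :=
  [set A : bpow | [forall i, A i \in even_bond u]].

Definition even_sdprod (u : V) : {set sdprod_by theta} :=
  [set sd A s | A in even_bpow u, s in [set: {perm starT}]].

Lemma sw_sum (u : V) U :
  u \notin U -> sw u (\sum_(v in U) star v) = #|U|.
Proof.
move=> uU; rewrite /sw; case: pickP => [D /andP[DD /eqP eD]|/(_ (star @: U))] /=.
  have {}DD : D = star @: [set v in [set~ u] | star v \in D].
    apply/setP=> H; apply/idP/imsetP => [HD|[v]]; last by rewrite inE => /andP[_ ?] ->.
    have /imsetP[v vu ev] := subsetP DD _ HD.
    by exists v; rewrite // inE vu -ev.
  have := eD; rewrite {1}DD big_imset /=; last by move=> ? ? _ _; apply: star_inj.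
  move/star_sum_eq; case=> eU.
    by rewrite DD eU card_imset //; apply: star_inj.
  by case/negP: uU; rewrite eU !inE eqxx.
rewrite big_imset /=; last by move=> ? ? _ _; apply: star_inj.
rewrite eqxx andbT => /negbT/subsetPn[H /imsetP[v vU ->]].
rewrite imset_f // !inE; by apply: contraNneq uU => <-.
Qed.

Lemma Delta_expr (u : V) (D : {set bond}) :
  D \subset Delta u -> sw u (\sum_(H in D) H) = #|D|.
Proof.
move=> /subsetP DD; pose U := [set v in [set~ u] | star v \in D].
have -> : D = star @: U.
  apply/setP=> H; apply/idP/imsetP => [HD|[v]]; last by rewrite inE => /andP[_ ?] ->.
  have /imsetP[v vu ev] := DD _ HD.
  by exists v; rewrite // inE vu -ev.
rewrite big_imset /=; last by move=> ? ? _ _; apply: star_inj.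
by rewrite sw_sum ?card_imset //; [apply: star_inj | rewrite !inE eqxx].
Qed.

Section EvenOrder.
Hypothesis nE : ~~ odd #|V|.
Variable u : V.

Lemma odd_sw_sum U : odd (sw u (\sum_(v in U) star v)) = odd #|U|.
Proof.
case: (boolP (u \in U)) => uU; last by rewrite sw_sum.
have -> : \sum_(v in U) star v = \sum_(v in ~: U) star v.
  have := star_sumT; rewrite (bigID (mem U)) /= => /eqP.
  rewrite addr_eq0 bondN => /eqP->.
  by apply: eq_bigl => v; rewrite inE.
rewrite sw_sum ?inE ?uU //; have := nE; rewrite -(cardsC U) oddD.
by case: (odd _); case: (odd _).
Qed.

Lemma even_bondD : {in even_bond u &, forall G H, G + H \in even_bond u}.
Proof.
move=> G H; have [U ->] := bondP G; have [W ->] := bondP H.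
rewrite star_sum_add !inE !odd_sw_sum => oU oW.
rewrite cardsU (_ : _ :&: _ = set0) ?cards0 ?subn0; last first.
  by apply/setP=> v; rewrite !inE; case: (v \in U); case: (v \in W).
have := cardsID W U; have := cardsID U W; rewrite [W :&: U]setIC oddD.
move=> eW eU; move: oU oW; rewrite -eU -eW !oddD.
by do 3!case: (odd _).
Qed.

Lemma thext_even s G : G \in even_bond u -> thext s G \in even_bond u.
Proof.
have [U ->] := bondP G; rewrite !inE odd_sw_sum => oU.
have [g gK Kg] := star_elt_bij; pose f v := g (s (star_elt v)).
have f_inj : injective f.
  move=> v w /(can_inj Kg)/perm_inj; exact: (can_inj gK).
suff -> : thext s (\sum_(v in U) star v) = \sum_(v in f @: U) star v.
  by rewrite odd_sw_sum card_imset.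
rewrite big_imset /=; last by move=> ? ? _ _; apply: f_inj.
have -> : \sum_(v in U) star v = \sum_(H in star_elt @: U) val H.
  by rewrite big_imset //= => ? ? _ _; apply: (can_inj gK).
rewrite thextE big_imset /=; last by move=> ? ? _ _; apply: (can_inj gK).
by apply: eq_bigr => v _; rewrite -[s _]Kg.
Qed.

Lemma even_sdprod_group : group_set (even_sdprod u).
Proof.
apply/group_setP; split.
  apply/imset2P; exists 0 1%g; rewrite ?inE //.
    apply/forallP=> i; rewrite !inE ffunE; have := odd_sw_sum set0.
    by rewrite big_set0 cards0 => ->.
  by rewrite /sd invg1 (morph1 (sdpair1_morphism theta)) (morph1 (sdpair2_morphism theta)) mulg1.
move=> _ _ /imset2P[A s Ae _ ->] /imset2P[B t Be _ ->].
rewrite inE in Ae; rewrite inE in Be.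
rewrite sdM; apply: imset2_f; last by rewrite inE.
rewrite inE.
apply/forallP=> i; rewrite ffunE even_bondD ?(forallP Ae) // ffunE.
by rewrite thext_even ?(forallP Be).
Qed.

End EvenOrder.

End Connected.
End BondSpace.

(* Main.v *)
Require Import Defs.
From mathcomp Require Import all_boot all_order all_algebra all_fingroup all_solvable.

Set Implicit Arguments.
Unset Strict Implicit.
Unset Printing Implicit Defensive.

Import GRing.Theory.

(** The generator [rho e] of an edge [e = {x, y}] exchanges the stars of [x]
    and [y], fixes the other stars, and moves every edge set by an element of
    the bond space [B].  So the edge-flipping group acts on [B] by permutations
    of the stars and trivially on the quotient of the edge space by [B].

    To write this in blocks, take a spanning tree [T].  Every edge set is
    uniquely a bond plus a set of chords (edges outside [T]), because a bond is
    determined by its trace on [T] and every subset of [T] is such a trace;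
    counting the traces gives [n - 1] tree edges, hence [m - n + 1] chords.
    A permutation [s] of the stars and a family [A] of bonds indexed by the
    chords define the block triangular map [tri A s] that acts on [B] as the
    linear extension of [s] and sends the [i]-th chord to itself plus [A i].
    These maps compose as the elements of the semidirect product of [B^(m-n+1)]
    by the symmetric group do, up to the order of the factors ([triM]).

    The generators are [rho e = tri 0 tau] for a tree edge [e = {x, y}] and
    [rho e = tri (star x + star y at i) tau] for the [i]-th chord, where [tau]
    exchanges the stars of [x] and [y].  The tree connects all vertices, so the
    tree edges already generate every [tri 0 s] ([tri0_in]).  Dividing a chord
    generator by its [tri 0 tau] and conjugating by the [tri 0 s] yields the
    maps [tri A 1] in which [A] is a sum [star x + star v] at one chord, and
    these generate all [tri A 1] whose entries are sums of evenly many stars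
    ([tri_even_in]).  No other entries occur: those of the generators are of
    this kind, which addition and permutations of the stars preserve.  For odd
    [n] every bond is such a sum, because a vertex set and its complement have
    the same cut and opposite parities; for even [n] the sums of evenly many
    stars are the bonds of even simple weight. *)

(** * Spanning trees and fundamental cuts *)

Section SpanningTree.
Local Open Scope ring_scope.
Variables (V : finType) (X : sgraph V).
Hypothesis hc : connected_graph X.
Implicit Types (G H T : espace X) (b : bond X) (U W : {set V}) (e : edge X).

Lemma espaceID G H T :
  (G + H) :&: T = (G :&: T : espace X) + (H :&: T : espace X).
Proof.
apply/setP=> e; rewrite in_setI !in_espaceD !in_setI.
by case: (e \in T); rewrite ?andbT ?andbF.
Qed.

Lemma espaceE G : G = \sum_(e in G) ([set e] : espace X).
Proof.
apply/setP=> e; rewrite in_espace_sum.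
have -> : (\sum_(f in G) (e \in ([set f] : espace X)) = (e \in G))%N; last first.
  by case: (e \in G).
rewrite big_mkcond (bigD1 e) //= inE eqxx big1 ?addn0; first by case: (e \in G).
by move=> f fe; rewrite inE eq_sym (negPf fe) if_same.
Qed.

Lemma cutC U : cut X (~: U) = cut X U.
Proof.
rewrite -!val_star_sum; congr val; rewrite -[RHS]bondN.
apply/eqP; rewrite -addr_eq0.
rewrite addrC; apply/eqP; rewrite -[RHS](star_sumT X) [RHS](bigID (mem U)) /=.
by congr (_ + _); apply: eq_bigl => v; rewrite inE.
Qed.

(** Connectedness of [(V, T)], said through cuts: no cut other than those of
    the empty and the full vertex set avoids [T].  In this form minimality
    gives the fundamental cuts at once. *)
Definition meets_cuts T :=
  [forall U : {set V}, (cut X U :&: T == set0) ==> (U == set0) || (U == setT)].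

Definition spanning_tree T := minset meets_cuts T.

Lemma ex_spanning_tree : {T | spanning_tree T}.
Proof.
apply: ex_minset; exists setT; apply/forallP=> U; apply/implyP.
by rewrite setIT => /eqP/(cut_eq0 hc)[] ->; rewrite eqxx ?orbT.
Qed.

Section Tree.
Variable T : espace X.
Hypothesis treeT : spanning_tree T.

Lemma tree_cut U : cut X U :&: T = set0 -> U = set0 \/ U = setT.
Proof.
have /forallP/(_ U)/implyP TU := minsetp treeT.
by move/eqP/TU/orP=> [] /eqP; [left | right].
Qed.

(** Deleting [e] from [T] must, by minimality, let some nontrivial cut avoid
    the rest of [T]; as [T] itself meets that cut, it does so in [e] alone. *)
Lemma fundamental_cut e : e \in T -> exists U, cut X U :&: T = [set e].
Proof.
move=> eT; have /forallPn[U] : ~~ meets_cuts (T :\ e).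
  apply/negP=> Te; have := eT; rewrite -(minsetinf treeT Te (subsetDl _ _)).
  by rewrite !inE eqxx.
rewrite negb_imply negb_or => /and3P[/eqP/setP cU U0 UT]; exists U.
apply/setP=> f; rewrite in_set1; have [->|fe] := eqVneq f e; last first.
  by have := cU f; rewrite in_setI in_setD1 in_set0 in_setI fe.
rewrite in_setI eT andbT; apply: contraNT UT => eU.
case: (@tree_cut U) => [|U0'|->//]; last by rewrite U0' eqxx in U0.
apply/setP=> g; rewrite in_setI in_set0; have [->|ge] := eqVneq g e.
  by rewrite (negPf eU).
by have := cU g; rewrite in_setI in_setD1 in_set0 ge.
Qed.

Lemma bond_eq0 b : val b :&: T = set0 -> b = 0.
Proof.
have [U ->] := bondP b; rewrite val_star_sum => /tree_cut[] ->.
  by rewrite big_set0.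
by rewrite -[RHS](star_sumT X); apply: eq_bigl => v; rewrite inE.
Qed.

Lemma bond_eq b1 b2 : val b1 :&: T = val b2 :&: T -> b1 = b2.
Proof.
move=> b12; apply/eqP; rewrite -[b2]bondN -addr_eq0; apply/eqP/bond_eq0.
by rewrite linearD /= espaceID b12 espaceDD.
Qed.

(** The fundamental cuts of the edges in [G :&: T] add up to a bond with this
    trace on [T]. *)
Lemma ex_tree_bond G : exists b, val b :&: T = G :&: T.
Proof.
rewrite (espaceE (G :&: T)).
apply: (big_ind (fun H => exists b, val b :&: T = H)).
- by exists 0; rewrite linear0 set0I.
- by move=> _ _ [b1 <-] [b2 <-]; exists (b1 + b2); rewrite linearD espaceID.
move=> e; rewrite inE => /andP[_ /fundamental_cut[U eU]].
by exists (\sum_(v in U) star X v); rewrite val_star_sum.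
Qed.

(** A vertex set avoiding [u] is determined by the trace of its cut on [T], and
    every subset of [T] is such a trace, so there are [2 ^ #|T|] of them. *)
Lemma card_tree (u : V) : #|T|.+1 = #|V|.
Proof.
pose D := powerset [set~ u]; pose f U := cut X U :&: T.
have inD U : (U \in D) = (u \notin U).
  by rewrite inE -disjoints_subset disjoint_sym disjoints1.
have fI : {in D &, injective f}.
  move=> U1 U2; rewrite !inD => uU1 uU2; rewrite /f -!val_star_sum.
  move/bond_eq/(star_sum_eq hc) => [->//|U2E]; move: uU1 uU2; rewrite U2E.
  by rewrite inE negbK => /negP.
have fD : f @: D = powerset T.
  apply/setP=> F; apply/imsetP/idP => [[U _ ->]|]; first by rewrite inE subsetIr.
  rewrite inE => /setIidPl FT; have [b] := ex_tree_bond F.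
  have [U ->] := bondP b; rewrite val_star_sum FT => <-.
  have [uU|uU] := boolP (u \in U); last by exists U; rewrite // inD.
  by exists (~: U); rewrite /f ?cutC // inD inE negbK.
have := card_in_imset fI; rewrite fD !card_powerset => /eqP.
rewrite eqn_exp2l // => /eqP->; rewrite cardsC1 prednK //.
by apply/card_gt0P; exists u.
Qed.

(** [bproj] and [cproj] are the projections onto the two summands of the edge
    space: the bonds, and the edge sets disjoint from [T]. *)
Definition bproj G : bond X :=
  odflt (0 : bond X) [pick b : bond X | val b :&: T == G :&: T].

Definition cproj G : espace X := G + val (bproj G).

Lemma bprojP G : val (bproj G) :&: T = G :&: T.
Proof.
rewrite /bproj; case: pickP => [b /eqP //|no]; have [b bG] := ex_tree_bond G.
by have := no b; rewrite bG eqxx.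
Qed.

Lemma bprojD G H : bproj (G + H) = bproj G + bproj H.
Proof. by apply: bond_eq; rewrite linearD /= bprojP !espaceID !bprojP. Qed.

Lemma bproj_bond b : bproj (val b) = b.
Proof. by apply: bond_eq; rewrite bprojP. Qed.

Lemma bproj_cproj G : bproj (cproj G) = 0.
Proof. by rewrite bprojD bproj_bond bondDD. Qed.

Lemma cprojD G H : cproj (G + H) = cproj G + cproj H.
Proof. by rewrite /cproj bprojD linearD addrACA. Qed.

Lemma cproj_bond b : cproj (val b) = 0.
Proof. by rewrite /cproj bproj_bond espaceDD. Qed.

Lemma cproj_id G : bproj G = 0 -> cproj G = G.
Proof. by move=> G0; rewrite /cproj G0 linear0 addr0. Qed.

Lemma cproj_out G e : e \in cproj G -> e \notin T.
Proof.
move=> ec; apply/negP=> eT; have := bprojP (cproj G).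
rewrite bproj_cproj linear0 set0I => /setP/(_ e).
by rewrite inE in_setI ec eT.
Qed.

Lemma bproj_out e : e \notin T -> bproj [set e] = 0.
Proof.
move=> eT; apply: bond_eq; rewrite bprojP linear0 set0I.
by apply/setP=> f; rewrite !inE; case: eqP => // ->; rewrite (negPf eT).
Qed.

Lemma proj_sum G : cproj G + val (bproj G) = G.
Proof. by rewrite /cproj -addrA espaceDD addr0. Qed.

End Tree.
End SpanningTree.

(** * Edges acting on bonds *)

Section EdgeStars.
Local Open Scope ring_scope.
Variables (V : finType) (X : sgraph V).
Hypothesis hc : connected_graph X.
Hypothesis hn : (2 < #|V|)%N.
Implicit Types (G H : espace X) (b : bond X) (U W : {set V}) (e : edge X).

Lemma edge_ends e : exists x y : V, x != y /\ val e = [set x; y].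
Proof. by apply/cards2P; rewrite (edges_card2 (valP e)). Qed.

Lemma in_cut2 x y e U : val e = [set x; y] -> x != y ->
  (e \in cut X U) = (x \in U) (+) (y \in U).
Proof.
move=> exy xy; rewrite inE exy.
have -> : #|[set x; y] :&: U| = ((x \in U) + (y \in U))%N.
  rewrite -sum1_card (eq_bigl _ _ (fun v => in_setI v _ U)) big_mkcondr /=.
  by rewrite big_setU1 ?inE // big_set1; case: (x \in U); case: (y \in U).
by case: (x \in U); case: (y \in U).
Qed.

Lemma cut2 x y : x != y -> cut X [set x; y] = val (star X x + star X y).
Proof.
by move=> xy; rewrite -val_star_sum big_setU1 ?inE // big_set1.
Qed.

Lemma thextD s b1 b2 : thext s (b1 + b2) = thext s b1 + thext s b2.
Proof. by rewrite -[b1]scale1r thext_linear // !scale1r. Qed.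

Lemma thext0 s : thext s (0 : bond X) = 0.
Proof. by have := thextD s 0 0; rewrite addr0 bondDD. Qed.

Lemma bond_ind (P : bond X -> Prop) :
  P 0 -> (forall b1 b2, P b1 -> P b2 -> P (b1 + b2)) ->
  (forall v, P (star X v)) -> forall b, P b.
Proof. by move=> P0 PD Pstar b; have [U ->] := bondP b; apply: big_ind. Qed.

(** Both sides are linear in [b], so it is enough to compare them on stars:
    [e] lies in the stars of [x] and [y] only, and adding [star x + star y]
    to either of these gives the other. *)
Lemma thext_tperm x y e b : val e = [set x; y] -> x != y ->
  thext (tperm (star_elt X x) (star_elt X y)) b
    = b + (if e \in val b then star X x + star X y else 0).
Proof.
move=> exy xy; have inj_se := bij_inj (star_elt_bij hc hn).
elim/bond_ind: b => [|b1 b2 IH1 IH2|v].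
- by rewrite thext0 linear0 in_espace0 addr0.
- rewrite thextD IH1 IH2 linearD in_espaceD addrACA; congr (_ + _).
  by case: (e \in val b1); case: (e \in val b2); rewrite ?addr0 ?add0r ?bondDD.
rewrite thext_star // (in_cut2 _ exy xy) !inE.
have [<-|xv] := eqVneq x v; last first.
  have [<-|yv] := eqVneq y v; first by rewrite tpermR addrC -addrA bondDD addr0.
  by rewrite tpermD ?addr0 // (inj_eq inj_se).
by rewrite [y == x]eq_sym (negPf xy) tpermL addrA bondDD add0r.
Qed.

End EdgeStars.

(** * The block triangular maps *)

Section Action.
Local Open Scope ring_scope.
Variables (V : finType) (X : sgraph V).
Hypothesis hc : connected_graph X.
Hypothesis hn : (2 < #|V|)%N.
Variable T : espace X.
Hypothesis treeT : spanning_tree T.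
Variable chord : 'I_(#|edges X|.+1 - #|V|) -> edge X.
Hypothesis chord_inj : injective chord.
Hypothesis chordP : forall e, e \notin T <-> exists i, chord i = e.
Implicit Types (G H : espace X) (A B : bpow X) (b : bond X).
Implicit Types (s t : {perm starT X}) (e : edge X) (U W : {set V}).

(** The linear map from edge sets to bonds that sends the [i]-th chord to [A i]
    and the tree edges to [0]. *)
Definition shift A G : bond X := \sum_(i | chord i \in G) A i.

Lemma shiftDr A G H : shift A (G + H) = shift A G + shift A H.
Proof.
rewrite /shift !(big_mkcond (fun i => _ \in _)) -big_split /=.
apply: eq_bigr => i _; rewrite in_espaceD.
by case: (_ \in G); case: (_ \in H); rewrite ?addr0 ?add0r ?bondDD.
Qed.

Lemma shiftDl A B G : shift (A + B) G = shift A G + shift B G.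
Proof.
by rewrite /shift -big_split /=; apply: eq_bigr => i _; rewrite ffunE.
Qed.

Lemma shift0l G : shift 0 G = 0.
Proof. by rewrite /shift big1 // => i _; rewrite ffunE. Qed.

Lemma shift0r A : shift A 0 = 0.
Proof. by rewrite /shift big_pred0 // => i; rewrite in_espace0. Qed.

Lemma shift_chord A i : shift A [set chord i] = A i.
Proof.
rewrite /shift (big_pred1 i) // => j; rewrite inE.
exact: (inj_eq chord_inj).
Qed.

Lemma thext_shift s A G : thext s (shift A G) = shift (theta_fun A s) G.
Proof.
rewrite /shift (big_morph _ (thextD hc hn s) (thext0 hc hn s)).
by apply: eq_bigr => i _; rewrite ffunE.
Qed.

(** The block triangular map for the decomposition into chord sets and bonds:
    [s] acts on the bonds, and [A] is the off-diagonal block. *)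
Definition tri_map A s G : espace X :=
  cproj T G + val (thext s (bproj T G) + shift A (cproj T G)).

Lemma bproj_tri A s G :
  bproj T (tri_map A s G) = thext s (bproj T G) + shift A (cproj T G).
Proof.
by rewrite (bprojD treeT) (bproj_cproj treeT) (bproj_bond treeT) add0r.
Qed.

Lemma cproj_tri A s G : cproj T (tri_map A s G) = cproj T G.
Proof.
rewrite (cprojD treeT) (cproj_bond treeT) addr0.
by rewrite (cproj_id (bproj_cproj treeT _)).
Qed.

Lemma tri_mapM A B s t G :
  tri_map B t (tri_map A s G) = tri_map (B + theta_fun A t) (s * t)%g G.
Proof.
rewrite {1}/tri_map bproj_tri cproj_tri /tri_map.
rewrite thextD // -thextM //.
by rewrite thext_shift shiftDl (addrC (shift B _)) (addrA (thext _ _)).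
Qed.

Lemma tri_map1 G : tri_map 0 1%g G = G.
Proof. by rewrite /tri_map thext1 // shift0l addr0 proj_sum. Qed.

Lemma bpowDD A : A + A = 0.
Proof. by apply/ffunP=> i; rewrite !ffunE bondDD. Qed.

Lemma tri_map_inj A s : injective (tri_map A s).
Proof.
apply: (can_inj (g := tri_map (theta_fun A s^-1%g) s^-1%g)) => G.
by rewrite tri_mapM mulgV bpowDD tri_map1.
Qed.

Definition tri A s : {perm espace X} := perm (@tri_map_inj A s).

(** Permutations compose from left to right, so this is the product rule of the
    semidirect product with the two factors exchanged. *)
Lemma triM A B s t : (tri A s * tri B t)%g = tri (B + theta_fun A t) (s * t).
Proof. by apply/permP=> G; rewrite permM !permE tri_mapM. Qed.

(** This lemma and [tri_chord] read [s] and [A] back from [tri A s]. *)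
Lemma tri_bond A s b : tri A s (val b) = val (thext s b).
Proof.
rewrite permE /tri_map (cproj_bond treeT) (bproj_bond treeT).
by rewrite shift0r addr0 add0r.
Qed.

Lemma tri_chord A s i :
  tri A s [set chord i] = ([set chord i] : espace X) + val (A i).
Proof.
have iT : bproj T [set chord i] = 0.
  by apply: bproj_out treeT _ _ => //; apply/chordP; exists i.
by rewrite permE /tri_map cproj_id // iT thext0 // add0r shift_chord.
Qed.

Lemma tri_inj A B s t : tri A s = tri B t -> A = B /\ s = t.
Proof.
move=> /permP E; split.
  apply/ffunP=> i; have := E [set chord i]; rewrite !tri_chord.
  by move/addrI/val_inj.
apply/permP=> H; have [g gK Kg] := star_elt_bij hc hn.
have := E (val (star X (g H))); rewrite !tri_bond !thext_star //.
by rewrite Kg => /val_inj/val_inj.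
Qed.

Definition single i b : bpow X := [ffun j => if j == i then b else 0].

Lemma shift_single i b G :
  shift (single i b) G = if chord i \in G then b else 0.
Proof.
rewrite /shift big_mkcond (bigD1 i) //= ffunE eqxx big1 ?addr0 // => j ji.
by rewrite ffunE (negPf ji) if_same.
Qed.

(** * The generators as block triangular maps *)

Section Edge.
Variables (e : edge X) (x y : V).
Hypotheses (exy : val e = [set x; y]) (xy : x != y).
Let tp := tperm (star_elt X x) (star_elt X y).
Let d := star X x + star X y.

(** [e] lies in an edge set when it lies in exactly one of its two components.
    For the bond component, adding [star x + star y] in this case is the
    action of the transposition; for the chord component it is the shift. *)
Lemma rho_tri A :
  (forall G, shift A (cproj T G) = if e \in cproj T G then d else 0) ->
  rho e = tri A tp.
Proof.
move=> Ae; apply/permP=> G; rewrite !permE /rho_fun /tri_map Ae.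
rewrite (thext_tperm hc hn _ exy) // exy cut2 // -/d -{1 2 3}(proj_sum T G).
have valD b1 b2 : val (b1 + b2 : bond X) = val b1 + val b2 by rewrite linearD.
move: (cproj T G) (bproj T G) d => c b D; rewrite in_espaceD !valD.
case: (e \in c); case: (e \in val b); rewrite /= ?linear0 ?addr0 ?addrA //.
by rewrite -addrA espaceDD addr0.
Qed.

Lemma rho_tree : e \in T -> rho e = tri 0 tp.
Proof.
move=> eT; apply: rho_tri => G; rewrite shift0l.
by case: ifP => // /(cproj_out treeT); rewrite eT.
Qed.

Lemma rho_chord i : chord i = e -> rho e = tri (single i d) tp.
Proof. by move=> ie; apply: rho_tri => G; rewrite shift_single ie. Qed.

End Edge.

(** * Generating the group *)

Section Generation.

Let W := edge_flipping_group X.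

Lemma theta_fun0 s : theta_fun 0 s = 0 :> bpow X.
Proof. by apply/ffunP=> i; rewrite !ffunE thext0. Qed.

Lemma theta_fun_1 A : theta_fun A 1%g = A.
Proof. by apply/ffunP=> i; rewrite ffunE thext1. Qed.

Lemma tri1 : tri 0 1%g = 1%g.
Proof. by apply/permP=> G; rewrite permE tri_map1 perm1. Qed.

Lemma triE A s : tri A s = (tri 0 s * tri A 1)%g.
Proof. by rewrite triM theta_fun0 addr0 mulg1. Qed.

(** The vertices [z] such that the transposition of the stars of [x] and [z]
    is reached form a set whose cut avoids [T], because conjugation by a
    transposition along a tree edge carries one endpoint to the other.  Hence
    this set is all of [V], and transpositions generate the symmetric group. *)
Lemma tri0_in s : tri 0 s \in W.
Proof.
have WM s1 s2 : tri 0 s1 \in W -> tri 0 s2 \in W -> tri 0 (s1 * s2)%g \in W.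
  by move=> W1 W2; have := groupM W1 W2; rewrite triM theta_fun0 addr0.
have W1 : tri 0 1%g \in W by rewrite tri1 group1.
have inj_se := bij_inj (star_elt_bij hc hn).
have Wt x y : tri 0 (tperm (star_elt X x) (star_elt X y)) \in W.
  pose U := [set z | tri 0 (tperm (star_elt X x) (star_elt X z)) \in W].
  have xU : x \in U by rewrite inE tperm1.
  have stepU e z w :
      e \in T -> val e = [set z; w] -> z != w -> z \in U -> w \in U.
    move=> eT ezw zw; rewrite !inE => Wz.
    have Wzw : tri 0 (tperm (star_elt X z) (star_elt X w)) \in W.
      by rewrite -(rho_tree ezw zw eT) mem_gen // imset_f.
    have [->|wx] := eqVneq w x; first by rewrite tperm1.
    have [<-//|zx] := eqVneq z x.
    have := WM _ _ (WM _ _ Wzw Wz) Wzw.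
    rewrite -{1}tpermV -mulgA -/(conjg _ _) tpermJ tpermL tpermD //;
      by rewrite (inj_eq inj_se).
  (* A tree edge in the cut of U would have just one endpoint in U. *)
  have: cut X U :&: T = set0.
    apply/setP=> e; rewrite in_setI in_set0; apply/andP=> -[eU eT].
    have [z [w [zw ezw]]] := edge_ends e.
    have := eU; rewrite (in_cut2 _ ezw zw).
    have zwU := stepU e z w eT ezw zw.
    have wzU : w \in U -> z \in U.
      by apply: stepU eT _ _; rewrite 1?setUC 1?eq_sym.
    by case: (z \in U) zwU wzU => [->|_] //; case: (w \in U) => // ->.
  case/(tree_cut treeT) => UE; first by rewrite UE inE in xU.
  by have := in_setT y; rewrite -UE inE.
have [ts -> _] := prod_tpermP s; have [g gK Kg] := star_elt_bij hc hn.
elim: ts => [|[H K] ts IH]; first by rewrite big_nil.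
by rewrite big_cons WM //= -(Kg H) -(Kg K).
Qed.

Lemma tri_theta_in A s : tri A 1%g \in W -> tri (theta_fun A s) 1%g \in W.
Proof.
move=> WA; have := groupM (groupM (tri0_in s^-1%g) WA) (tri0_in s).
by rewrite !triM !theta_fun0 add0r addr0 mulg1 mulVg.
Qed.

Lemma triD_in A B :
  tri A 1%g \in W -> tri B 1%g \in W -> tri (A + B) 1%g \in W.
Proof.
by move=> WA WB; have := groupM WB WA; rewrite triM theta_fun_1 mulg1.
Qed.

Lemma singleD i b1 b2 : single i (b1 + b2) = single i b1 + single i b2.
Proof. by apply/ffunP=> j; rewrite !ffunE; case: eqP; rewrite ?addr0. Qed.

Lemma single0 i : single i 0 = 0.
Proof. by apply/ffunP=> j; rewrite !ffunE if_same. Qed.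

(** The case [v = y] is the generator of the chord, divided by [tri 0] of its
    transposition; conjugation by the transposition of [y] and [v] does the
    rest. *)
Lemma single_pair_in i x y v : val (chord i) = [set x; y] -> x != y ->
  tri (single i (star X x + star X v)) 1%g \in W.
Proof.
move=> exy xy; have inj_se := bij_inj (star_elt_bij hc hn).
have [->|vx] := eqVneq v x; first by rewrite bondDD single0 tri1 group1.
have Wy : tri (single i (star X x + star X y)) 1%g \in W.
  have We : rho (chord i) \in W by rewrite mem_gen // imset_f.
  have := groupM (tri0_in (tperm (star_elt X x) (star_elt X y))) We.
  by rewrite (rho_chord exy xy (erefl _)) triM theta_fun0 addr0 tperm2.
have := tri_theta_in (tperm (star_elt X y) (star_elt X v)) Wy.
suff -> : theta_fun (single i (star X x + star X y))
    (tperm (star_elt X y) (star_elt X v)) = single i (star X x + star X v) by [].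
apply/ffunP=> j; rewrite !ffunE; case: eqP => _; last by rewrite thext0.
rewrite thextD // !thext_star // tpermL tpermD //;
  by rewrite (inj_eq inj_se) // eq_sym.
Qed.

Lemma single_even_in i U : ~~ odd #|U| ->
  tri (single i (\sum_(v in U) star X v)) 1%g \in W.
Proof.
move=> evU; have [x [y [xy exy]]] := edge_ends (chord i).
(* The added copies of star x cancel, being even in number. *)
have -> : \sum_(v in U) star X v = \sum_(v in U) (star X x + star X v).
  rewrite big_split /= sumr_const -(odd_double_half #|U|) (negPf evU) -mul2n.
  by rewrite add0n mulrnA mulr2n bondDD mul0rn add0r.
apply: (big_ind (fun b => tri (single i b) 1%g \in W)).
- by rewrite single0 tri1 group1.
- by move=> b1 b2 W1 W2; rewrite singleD triD_in.
by move=> v _; apply: single_pair_in exy xy.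
Qed.

Lemma tri_even_in A s :
  (forall i, exists2 U : {set V}, ~~ odd #|U| & A i = \sum_(v in U) star X v) ->
  tri A s \in W.
Proof.
move=> evA; rewrite triE groupM ?tri0_in //.
have -> : A = \sum_i single i (A i).
  apply/ffunP=> j; rewrite sum_ffunE (bigD1 j) //= ffunE eqxx.
  rewrite big1 ?addr0 // => i ij; by rewrite ffunE eq_sym (negPf ij).
apply: (big_ind (fun B => tri B 1%g \in W)); first by rewrite tri1 group1.
  exact: triD_in.
by move=> i _; have [U evU ->] := evA i; apply: single_even_in.
Qed.

End Generation.

(** Both parities at once: [P] is the set of bonds that are sums of evenly many
    stars, described as suits the case.  The set [D] comes with a group
    structure, so that it is enough to find each [rho e] in its image. *)
Lemma flipping_isog_sd (P : {set bond X})
    (D : {group sdprod_by (theta hc hn)}) :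
    D = [set sd hc hn A s | A in [set A : bpow X | [forall i, A i \in P]],
                            s in [set: {perm starT X}]] :> {set _} ->
    (forall x y, star X x + star X y \in P) ->
    (forall b, b \in P ->
       exists2 U : {set V}, ~~ odd #|U| & b = \sum_(v in U) star X v) ->
  edge_flipping_group X \isog D.
Proof.
move=> DE Ppair Peven; have [k sdK Ksd] := sd_bij hc hn.
(* Inversion turns the reversed product of triM into a morphism. *)
pose f w := (tri (k w).1 (k w).2)^-1%g.
have fE A s : f (sd hc hn A s) = (tri A s)^-1%g by rewrite /f (sdK (A, s)).
have fM : {in [set: sdprod_by (theta hc hn)] &,
            {morph f : w1 w2 / (w1 * w2)%g}}.
  by move=> w1 w2 _ _; rewrite -(Ksd w1) -(Ksd w2) sdM !fE -invMg triM.
pose F := Morphism fM.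
have injF : ('injm F)%g.
  apply/injmP=> w1 w2 _ _ /invg_inj/tri_inj[k1 k2]; apply: (can_inj Ksd).
  by rewrite [k w1]surjective_pairing k1 k2 -surjective_pairing.
have sdD A s : (forall i, A i \in P) -> sd hc hn A s \in D.
  move=> AP; rewrite DE imset2_f ?inE //; exact/forallP.
have FD : (F @* D)%g = edge_flipping_group X.
  apply/eqP; rewrite eqEsubset; apply/andP; split; last first.
    rewrite gen_subG; apply/subsetP=> _ /imsetP[e _ ->].
    suff [A [s [AP ->]]] : exists A s, (forall i, A i \in P) /\ rho e = tri A s.
      by rewrite -groupV -fE (mem_morphim F) ?inE // sdD.
    have [x [y [xy exy]]] := edge_ends e.
    have P0 : 0 \in P by rewrite -(bondDD (star X x)) Ppair.
    pose tp := tperm (star_elt X x) (star_elt X y).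
    have [eT|/chordP[i ie]] := boolP (e \in T).
      by exists 0, tp; split=> [i|]; [rewrite ffunE | apply: rho_tree].
    exists (single i (star X x + star X y)), tp; split; last exact: rho_chord.
    by move=> j; rewrite ffunE; case: eqP.
  apply/subsetP=> _ /morphimP[w _ wD ->]; move: wD; rewrite DE.
  case/imset2P=> A s; rewrite inE => /forallP AP _ ->.
  by rewrite /= fE groupV tri_even_in // => i; apply: Peven.
by rewrite isog_sym -FD sub_isog ?subsetT.
Qed.

End Action.

(** * The theorem *)

Lemma ex_chords (V : finType) (X : sgraph V) (hc : connected_graph X) (u : V)
    (T : espace X) : spanning_tree T ->
  exists2 chord : 'I_(#|edges X|.+1 - #|V|) -> edge X,
    injective chord & forall e, e \notin T <-> exists i, chord i = e.
Proof.
move=> treeT; have cardT : (#|edges X|.+1 - #|V|)%N = #|~: T|.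
  have <- : #|edge X| = #|edges X| by rewrite card_sig; apply: eq_card.
  by rewrite -(card_tree hc treeT u) subSS -(cardsC T) addKn.
exists (fun i => enum_val (cast_ord cardT i)).
  by move=> i j /enum_val_inj/cast_ord_inj.
move=> e; rewrite -in_setC; split=> [eT|[i <-]]; last exact: enum_valP.
exists (cast_ord (esym cardT) (enum_rank_in eT e)).
by rewrite cast_ordKV enum_rankK_in.
Qed.

Local Open Scope group_scope.

Theorem theorem5p5 (V : finType) (X : sgraph V) (hc : connected_graph X)
    (hn : (3 <= #|V|)%N) (u : V) :
  (odd #|V| ->
     edge_flipping_group X \isog [set: sdprod_by (theta hc hn)])
  /\
  (~~ odd #|V| ->
     edge_flipping_group X \isog even_sdprod hc hn u).
Proof.
have [T treeT] := ex_spanning_tree hc.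
have [chord chord_inj chordP] := ex_chords hc u treeT.
have isog_sd := @flipping_isog_sd _ _ hc hn _ treeT _ chord_inj chordP.
split=> [nO | nE].
  apply: (isog_sd setT setT%G) => [|x y|b _]; rewrite ?inE //.
    apply/setP=> w; rewrite inE; apply/esym/imset2P.
    have [k _ Ksd] := sd_bij hc hn.
    exists (k w).1 (k w).2; rewrite ?inE ?Ksd //.
    by apply/forallP=> i; rewrite inE.
  have [U ->] := bondP b; have [oU|oU] := boolP (odd #|U|); last by exists U.
  (* A vertex set and its complement have the same cut. *)
  exists (~: U); last first.
    by apply: val_inj; rewrite !val_star_sum cutC.
  by have := nO; rewrite -(cardsC U) oddD oU.
pose D := Group (even_sdprod_group hc hn nE u).
apply: (isog_sd (even_bond X u) D) => [//|x y|b].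
- have [->|xy] := eqVneq x y.
    have := odd_sw_sum hc hn nE u (set0 : {set V}).
    by rewrite bondDD inE big_set0 cards0 => ->.
  have := odd_sw_sum hc hn nE u [set x; y].
  by rewrite inE cards2 xy big_setU1 ?inE // big_set1 => ->.
have [U ->] := bondP b; rewrite inE odd_sw_sum // => evU.
by exists U.
Qed.
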